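(* Let $P$ be a regular power series method and let $(G_j)_{j\in\mathbb{N}_0}$ be a sequence of positive linear operators from $C_{2\pi}(\mathbb{R})$ into $B(\mathbb{R})$. Then $$st_P-\lim_{j\to\infty}\|G_j(\psi)-\psi\|=0\qquad\text{for every }\psi\in C_{2\pi}(\mathbb{R})$$ if and only if $$st_P-\lim_{j\to\infty}\|G_j(\psi_\lambda)-\psi_\lambda\|=0\qquad\text{for }\lambda=1,2,3,$$ where $\psi_1(y)=1$, $\psi_2(y)=\cos y$, $\psi_3(y)=\sin y$.
   Context: $\mathbb{N}_0$ is the set of non-negative integers. A power series method $P=(s_j)_{j\ge0}$ is a real sequence with $s_0>0$ and $s_1,s_2,\dots\ge 0$ such that the power series $s(t)=\sum_{j=0}^\infty s_jt^j$ has radius of convergence $R$ with $0<R\le\infty$. It is regular if and only if $\lim_{0<t\to R^-}\frac{s_jt^j}{s(t)}=0$ for every $j\in\mathbb{N}_0$. For $E\subset\mathbb{N}_0$, the $P$-density of $E$ is $\delta_P(E)=\lim_{0<t\to R^-}\frac{1}{s(t)}\sum_{j\in E}s_jt^j$, whenever this limit exists. A real sequence $(x_j)$ is $P$-statistically convergent to $L$, written $st_P-\lim_{j\to\infty}x_j=L$, if for every $\varepsilon>0$, $\delta_P(\{j\in\mathbb{N}_0:|x_j-L|\ge\varepsilon\})=0$. $C_{2\pi}(\mathbb{R})$ is the space of all $2\pi$-periodic continuous real-valued functions on $\mathbb{R}$, $B(\mathbb{R})$ is the space of all bounded real-valued functions on $\mathbb{R}$, and $\|\cdot\|$ is the supremum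 norm on $\mathbb{R}$. A linear operator is positive if it maps non-negative functions to non-negative functions. *)

(* Defs.v *)
From Stdlib Require Import Reals Lra ClassicalEpsilon.
From Coquelicot Require Import Coquelicot.
Open Scope R_scope.

Definition power_series_method (s : nat -> R) : Prop :=
  0 < s 0%nat /\ (forall j : nat, 0 <= s j) /\ Rbar_lt 0 (CV_radius s).

(** One-sided limit as [0 < t] tends to the (possibly infinite) radius of
    convergence from the left. *)
Definition lim_to_radius (s : nat -> R) (f : R -> R) (l : R) : Prop :=
  filterlim f
    (within (fun t : R => 0 < t /\ Rbar_lt t (CV_radius s))
            (Rbar_locally (CV_radius s)))
    (locally l).

Definition regular (s : nat -> R) : Prop :=
  forall j : nat, lim_to_radius s (fun t => s j * t ^ j / PSeries s t) 0.

Definition restrict (E : nat -> Prop) (s : nat -> R) (j : nat) : R :=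
  if excluded_middle_informative (E j) then s j else 0.

(** The density is only a partial function of [E], hence a relation. *)
Definition is_P_density (s : nat -> R) (E : nat -> Prop) (d : R) : Prop :=
  lim_to_radius s (fun t => / PSeries s t * PSeries (restrict E s) t) d.

Definition st_lim (s : nat -> R) (x : nat -> R) (L : R) : Prop :=
  forall eps : R, 0 < eps ->
    is_P_density s (fun j => Rabs (x j - L) >= eps) 0.

Record C2pi : Type := mkC2pi {
  C2pi_fun :> R -> R;
  C2pi_continuous : forall x : R, continuous C2pi_fun x;
  C2pi_periodic : forall x : R, C2pi_fun (x + 2 * PI) = C2pi_fun x }.

Record Bounded : Type := mkBounded {
  Bounded_fun :> R -> R;
  Bounded_bound : exists M : R, forall x : R, Rabs (Bounded_fun x) <= M }.

(** Real-valued, so meaningful for bounded [f] only: [real] sends an infinite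
    supremum to 0. *)
Definition sup_norm (f : R -> R) : R :=
  real (Lub_Rbar (fun r => exists x : R, r = Rabs (f x))).

Program Definition C2pi_comb (a : R) (f : C2pi) (b : R) (g : C2pi) : C2pi :=
  mkC2pi (fun y => a * f y + b * g y) _ _.
Next Obligation.
  apply (continuous_plus (fun y => a * f y) (fun y => b * g y)).
  - exact (continuous_scal_r a f x (C2pi_continuous f x)).
  - exact (continuous_scal_r b g x (C2pi_continuous g x)).
Qed.
Next Obligation. now rewrite !C2pi_periodic. Qed.

Definition linear_operator (G : C2pi -> Bounded) : Prop :=
  forall (a b : R) (f g : C2pi) (y : R),
    G (C2pi_comb a f b g) y = a * G f y + b * G g y.

Definition positive_operator (G : C2pi -> Bounded) : Prop :=
  forall f : C2pi, (forall y : R, 0 <= f y) -> forall y : R, 0 <= G f y.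

Program Definition psi1 : C2pi := mkC2pi (fun _ => 1) _ _.
Next Obligation. apply continuous_const. Qed.

Program Definition psi2 : C2pi := mkC2pi cos _ _.
Next Obligation. apply continuous_cos. Qed.
Next Obligation. now rewrite cos_plus, cos_2PI, sin_2PI; ring. Qed.

Program Definition psi3 : C2pi := mkC2pi sin _ _.
Next Obligation. apply continuous_sin. Qed.
Next Obligation. now rewrite sin_plus, cos_2PI, sin_2PI; ring. Qed.

(* Main.v *)
Require Import Defs.
From Stdlib Require Import Reals Lra Lia ZArith ClassicalEpsilon.
From Coquelicot Require Import Coquelicot.
Open Scope R_scope.

(** By uniform continuity and periodicity,
    [|psi x - psi y| <= eps + K * (1 - cos (x - y))] for all [x], [y]. As
    [1 - cos (x - y)] is, for fixed [y], a combination of [1], [cos x] and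
    [sin x], applying the positive operator [G] and evaluating at [y] bounds
    [|G psi - psi|] by [eps] plus a constant times the sum of the three test
    norms. Hence the index set on which [|G_j psi - psi|] is large lies in the
    union of the three index sets on which a test norm is large, and a subset
    of a union of sets of density zero has density zero. *)

(** * Power series with nonnegative coefficients and sets of density zero *)

Lemma ex_series_restrict (s : nat -> R) (E : nat -> Prop) (t : R) :
  Rbar_lt (Rabs t) (CV_radius s) ->
  ex_series (fun k => restrict E s k * t ^ k).
Proof.
  intros Ht.
  apply (ex_series_le (K := R_AbsRing) (V := R_CompleteNormedModule)
           _ (fun k => Rabs (s k * t ^ k))); [| now apply CV_disk_inside].
  intros k; change (Rabs (restrict E s k * t ^ k) <= Rabs (s k * t ^ k)).
  unfold restrict; destruct (excluded_middle_informative (E k)); [lra |].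
  rewrite Rmult_0_l, Rabs_R0; apply Rabs_pos.
Qed.

Lemma restrict_nonneg (s : nat -> R) (E : nat -> Prop) (k : nat) :
  (forall j, 0 <= s j) -> 0 <= restrict E s k.
Proof.
  intros Hs; unfold restrict.
  destruct (excluded_middle_informative (E k)); [apply Hs | lra].
Qed.

Lemma PSeries_nonneg (a : nat -> R) (t : R) :
  (forall k, 0 <= a k) -> 0 <= t -> ex_series (fun k => a k * t ^ k) ->
  0 <= PSeries a t.
Proof.
  intros Ha Ht Hex; unfold PSeries.
  rewrite <- (Rmult_0_l (Series (fun k => a k * t ^ k))), <- Series_scal_l.
  apply Series_le; [| exact Hex].
  intros k; assert (0 <= a k * t ^ k)
    by (apply Rmult_le_pos; [apply Ha | now apply pow_le]); lra.
Qed.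

(** For [0 < t] below the radius all coefficients and powers are nonnegative, so the series over [E]
    is dominated termwise by the sum of the other two; each of the two quotients is eventually below
    [eps / 2]. *)
Lemma density_zero_subset_union (s : nat -> R) (E E1 E2 : nat -> Prop) :
  power_series_method s ->
  (forall j, E j -> E1 j \/ E2 j) ->
  is_P_density s E1 0 -> is_P_density s E2 0 -> is_P_density s E 0.
Proof.
  intros (_ & Hs & _) Hsub H1 H2.
  unfold is_P_density, lim_to_radius in *.
  apply filterlim_locally; intros eps.
  assert (He : 0 < eps / 2) by (destruct eps; simpl; lra).
  generalize (filter_and _ _
    (proj1 (filterlim_locally _ _) H1 (mkposreal _ He))
    (proj1 (filterlim_locally _ _) H2 (mkposreal _ He))).
  unfold within; apply filter_imp; intros t Ht [Htpos HtR].
  destruct (Ht (conj Htpos HtR)) as [Ht1 Ht2].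
  change (Rabs (/ PSeries s t * PSeries (restrict E1 s) t - 0) < eps / 2) in Ht1.
  change (Rabs (/ PSeries s t * PSeries (restrict E2 s) t - 0) < eps / 2) in Ht2.
  change (Rabs (/ PSeries s t * PSeries (restrict E s) t - 0) < eps).
  assert (Hin : Rbar_lt (Rabs t) (CV_radius s))
    by (rewrite Rabs_pos_eq; [exact HtR | lra]).
  assert (Hnn : forall A, 0 <= PSeries (restrict A s) t).
  { intros A; apply PSeries_nonneg; [| lra | now apply ex_series_restrict].
    intros k; now apply restrict_nonneg. }
  assert (Hle : PSeries (restrict E s) t <=
                PSeries (restrict E1 s) t + PSeries (restrict E2 s) t).
  { unfold PSeries; rewrite <- Series_plus by now apply ex_series_restrict.
    apply Series_le.
    - intros k.
      assert (Hk : 0 <= t ^ k) by (apply pow_le; lra).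
      split; [apply Rmult_le_pos; [now apply restrict_nonneg | exact Hk] |].
      rewrite <- Rmult_plus_distr_r; apply Rmult_le_compat_r; [exact Hk |].
      specialize (Hsub k); specialize (Hs k); unfold restrict.
      destruct (excluded_middle_informative (E k));
        destruct (excluded_middle_informative (E1 k));
        destruct (excluded_middle_informative (E2 k)); try lra; tauto.
    - apply (ex_series_plus (K := R_AbsRing) (V := R_NormedModule));
        now apply ex_series_restrict. }
  assert (Hinv : 0 <= / PSeries s t).
  { destruct (PSeries_nonneg s t) as [Hlt | <-]; [exact Hs | lra | | |].
    - apply ex_series_Rabs; now apply CV_disk_inside.
    - now apply Rlt_le, Rinv_0_lt_compat.
    (* A vanishing denominator is covered by the convention [/ 0 = 0]. *)
    - rewrite Rinv_0; lra. }
  rewrite Rminus_0_r, Rabs_pos_eq in * by now apply Rmult_le_pos.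
  apply Rle_lt_trans with (/ PSeries s t *
    (PSeries (restrict E1 s) t + PSeries (restrict E2 s) t)).
  - now apply Rmult_le_compat_l.
  - lra.
Qed.

(** * The supremum norm as a finite least upper bound *)

Lemma sup_norm_le (f : R -> R) (M : R) :
  (forall x, Rabs (f x) <= M) -> sup_norm f <= M.
Proof.
  intros Hf; unfold sup_norm.
  destruct (Lub_Rbar_correct (fun r => exists x, r = Rabs (f x))) as [Hub Hlub].
  (* The value at 0 rules out [m_infty] and the bound [M] rules out [p_infty], so [real] returns the
     true supremum. *)
  specialize (Hub _ (ex_intro _ 0 eq_refl)).
  assert (H : Rbar_le (Lub_Rbar (fun r => exists x, r = Rabs (f x))) M).
  { apply Hlub; intros r [x ->]; apply Hf. }
  destruct (Lub_Rbar _); simpl in *; tauto.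
Qed.

(** The bound [M] serves only to make the supremum finite, so that [real] does not fall back to
    0. *)
Lemma Rabs_le_sup_norm (f : R -> R) (M x : R) :
  (forall z, Rabs (f z) <= M) -> Rabs (f x) <= sup_norm f.
Proof.
  intros Hf; unfold sup_norm.
  destruct (Lub_Rbar_correct (fun r => exists x, r = Rabs (f x))) as [Hub Hlub].
  specialize (Hub _ (ex_intro _ x eq_refl)).
  assert (H : Rbar_le (Lub_Rbar (fun r => exists x, r = Rabs (f x))) M).
  { apply Hlub; intros r [z ->]; apply Hf. }
  destruct (Lub_Rbar _); simpl in *; tauto.
Qed.

(** * Periodic continuous functions *)

Lemma C2pi_periodic_Z (psi : C2pi) (n : Z) (x : R) :
  psi (x + 2 * PI * IZR n) = psi x.
Proof.
  assert (Hnat : forall (k : nat) z, psi (z + 2 * PI * INR k) = psi z).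
  { induction k as [| k IH]; intros z.
    - f_equal; simpl; ring.
    - rewrite S_INR, <- (IH z), <- (C2pi_periodic psi (z + 2 * PI * INR k)).
      f_equal; ring. }
  destruct (Z_le_gt_dec 0 n) as [Hn | Hn].
  - rewrite <- (Z2Nat.id n Hn), <- INR_IZR_INZ; apply Hnat.
  - rewrite <- (Hnat (Z.to_nat (- n)) (x + 2 * PI * IZR n)); f_equal.
    rewrite INR_IZR_INZ, Z2Nat.id by lia; rewrite opp_IZR; ring.
Qed.

Lemma translate_into_period (a x : R) :
  exists n : Z, a <= x + 2 * PI * IZR n < a + 2 * PI.
Proof.
  exists (- Int_part ((x - a) / (2 * PI)))%Z; rewrite opp_IZR.
  destruct (base_Int_part ((x - a) / (2 * PI))) as [H1 H2].
  pose proof PI_RGT_0 as Hpi.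
  set (q := (x - a) / (2 * PI)) in *.
  assert (Hx : x = a + 2 * PI * q) by (unfold q; field; lra).
  (* The translate equals [a + 2 * PI * (q - m)], where [q - m] is the fractional part of [q]. *)
  rewrite Hx; set (m := IZR (Int_part q)) in *; split; nra.
Qed.

Lemma C2pi_continuity_pt (psi : C2pi) (x : R) : continuity_pt psi x.
Proof. apply continuity_pt_filterlim, C2pi_continuous. Qed.

Lemma C2pi_bounded (psi : C2pi) :
  exists M, 0 <= M /\ forall x, Rabs (psi x) <= M.
Proof.
  pose proof PI_RGT_0 as Hpi.
  destruct (continuity_ab_maj (fun x => Rabs (psi x)) 0 (2 * PI))
    as [z [Hz _]].
  - lra.
  - intros c _.
    apply (continuity_pt_comp psi Rabs);
      [apply C2pi_continuity_pt | apply Rcontinuity_abs].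
  - exists (Rabs (psi z)); split; [apply Rabs_pos |]; intros x.
    destruct (translate_into_period 0 x) as [n Hn].
    rewrite <- (C2pi_periodic_Z psi n); apply Hz; lra.
Qed.

(** Modulo the period, nearby points are handled by uniform continuity, which gives [eps]; for the
    others [1 - cos (x - y)] is bounded below, and a large [K] covers the trivial bound [2 * M]. *)
Lemma C2pi_modulus (psi : C2pi) (eps : R) :
  0 < eps ->
  exists K, 0 <= K /\
    forall x y, Rabs (psi x - psi y) <= eps + K * (1 - cos (x - y)).
Proof.
  intros Heps; pose proof PI_RGT_0 as Hpi.
  destruct (C2pi_bounded psi) as [M [HM HMb]].
  (* This interval contains every pair [x'], [y'] below: [y'] lies in [[0, 2 * PI)] and [x'] within
     [PI] of it. *)
  destruct (@Heine_cor2 psi (- PI) (3 * PI)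
              (fun x _ => C2pi_continuity_pt psi x) (mkposreal eps Heps))
    as [[d Hd] Hunif]; simpl in Hunif.
  (* The cap at [PI] keeps [e] in the range where [cos] decreases. *)
  set (e := Rmin d PI).
  assert (He : 0 < e) by (now apply Rmin_glb_lt).
  assert (Hed : e <= d) by apply Rmin_l.
  assert (Hepi : e <= PI) by apply Rmin_r.
  assert (Hcos : cos e < 1)
    by (rewrite <- cos_0; apply cos_decreasing_1; lra).
  set (K := 2 * M / (1 - cos e)).
  assert (HK : 0 <= K)
    by (unfold K; apply Rdiv_le_0_compat; lra).
  assert (HKe : K * (1 - cos e) = 2 * M) by (unfold K; field; lra).
  exists K; split; [exact HK |]; intros x y.
  destruct (translate_into_period 0 y) as [m Hm].
  set (y' := y + 2 * PI * IZR m) in *.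
  (* Centring the period at [y'] gives [Rabs (x' - y') <= PI], so [cos (x' - y')] decreases with the
     distance. *)
  destruct (translate_into_period (y' - PI) x) as [n Hn].
  set (x' := x + 2 * PI * IZR n) in *.
  replace (psi x) with (psi x') by apply C2pi_periodic_Z.
  replace (psi y) with (psi y') by apply C2pi_periodic_Z.
  replace (cos (x - y)) with (cos (x' - y')).
  2: { change (cos (x' - y') = psi2 (x - y)).
       rewrite <- (C2pi_periodic_Z psi2 (n - m) (x - y)); simpl; f_equal.
       rewrite minus_IZR; unfold x', y'; ring. }
  pose proof (COS_bound (x' - y')) as Hcb.
  destruct (Rlt_le_dec (Rabs (x' - y')) e) as [Hlt | Hge].
  - assert (Rabs (psi x' - psi y') < eps) by (apply Hunif; lra).
    nra.
  - assert (Hc : cos (x' - y') <= cos e).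
    { replace (cos (x' - y')) with (cos (Rabs (x' - y')))
        by (unfold Rabs; destruct (Rcase_abs _); [apply cos_neg | easy]).
      assert (Rabs (x' - y') <= PI) by (apply Rabs_le; lra).
      apply cos_decr_1; lra. }
    pose proof (Rabs_triang (psi x') (- psi y')) as Htri.
    rewrite Rabs_Ropp in Htri.
    pose proof (HMb x'); pose proof (HMb y').
    unfold Rminus at 1; nra.
Qed.

(** * Estimates for a single positive linear operator *)

Section PositiveOperator.

Variable G : C2pi -> Bounded.
Hypothesis G_linear : linear_operator G.
Hypothesis G_positive : positive_operator G.

Lemma positive_operator_monotone (f g : C2pi) (y : R) :
  (forall x, f x <= g x) -> G f y <= G g y.
Proof.
  intros Hfg.
  assert (H : 0 <= G (C2pi_comb 1 g (-1) f) y).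
  { apply G_positive; intros x; simpl; specialize (Hfg x); lra. }
  rewrite G_linear in H; lra.
Qed.

Lemma operator_difference_bounded (psi : C2pi) :
  exists M, forall y, Rabs (G psi y - psi y) <= M.
Proof.
  destruct (Bounded_bound (G psi)) as [M1 H1].
  destruct (C2pi_bounded psi) as [M2 [_ H2]].
  exists (M1 + M2); intros y.
  pose proof (Rabs_triang (G psi y) (- psi y)) as H; rewrite Rabs_Ropp in H.
  specialize (H1 y); specialize (H2 y); unfold Rminus; lra.
Qed.

Lemma Rabs_le_operator_sup_norm (psi : C2pi) (y : R) :
  Rabs (G psi y - psi y) <= sup_norm (fun y => G psi y - psi y).
Proof.
  destruct (operator_difference_bounded psi) as [M HM].
  exact (Rabs_le_sup_norm (fun y => G psi y - psi y) M y HM).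
Qed.

(** Split [G psi y - psi y] into [G psi y - psi y * G psi1 y], bounded by [G h y] with [h] as below,
    and [psi y * (G psi1 y - 1)], which accounts for [M]. *)
Lemma positive_operator_estimate (psi : C2pi) (eps K M : R) :
  0 <= eps -> 0 <= K ->
  (forall x, Rabs (psi x) <= M) ->
  (forall x y, Rabs (psi x - psi y) <= eps + K * (1 - cos (x - y))) ->
  sup_norm (fun y => G psi y - psi y) <=
  eps + (eps + K + M) *
    (sup_norm (fun y => G psi1 y - psi1 y) +
     sup_norm (fun y => G psi2 y - psi2 y) +
     sup_norm (fun y => G psi3 y - psi3 y)).
Proof.
  intros Heps HK HM Hmod; apply sup_norm_le; intros y.
  pose proof (Rabs_le_operator_sup_norm psi1 y) as H1.
  pose proof (Rabs_le_operator_sup_norm psi2 y) as H2.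
  pose proof (Rabs_le_operator_sup_norm psi3 y) as H3.
  set (a := sup_norm (fun y => G psi1 y - psi1 y)) in *.
  set (b := sup_norm (fun y => G psi2 y - psi2 y)) in *.
  set (c := sup_norm (fun y => G psi3 y - psi3 y)) in *.
  simpl in H1, H2, H3.
  (* [h x = eps + K * (1 - cos (x - y))] *)
  set (h := C2pi_comb (eps + K) psi1 (- K)
              (C2pi_comb (cos y) psi2 (sin y) psi3)).
  assert (Hh : forall x, psi y - h x <= psi x <= psi y + h x).
  { intros x; specialize (Hmod x y); apply Rabs_le_between in Hmod.
    rewrite cos_minus in Hmod; simpl; lra. }
  assert (Hup : G psi y <= psi y * G psi1 y + 1 * G h y).
  { rewrite <- G_linear; apply positive_operator_monotone.
    intros x; specialize (Hh x); simpl in *; lra. }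
  assert (Hlo : psi y * G psi1 y + -1 * G h y <= G psi y).
  { rewrite <- G_linear; apply positive_operator_monotone.
    intros x; specialize (Hh x); simpl in *; lra. }
  (* Since [sin y ^ 2 + cos y ^ 2 = 1], the constant terms multiplied by [K] cancel, leaving
     [h y = eps] and the deviations on the test functions. *)
  assert (Hhy : G h y = eps + eps * (G psi1 y - 1) +
      K * ((G psi1 y - 1) - cos y * (G psi2 y - cos y)
           - sin y * (G psi3 y - sin y))).
  { unfold h; rewrite !G_linear.
    pose proof (sin2_cos2 y) as Hsc; unfold Rsqr in Hsc.
    replace (G psi1 y) with
      (G psi1 y - 1 + (sin y * sin y + cos y * cos y)) at 1 by lra.
    replace (eps + eps * (G psi1 y - 1)) with
      (eps * (sin y * sin y + cos y * cos y) + eps * (G psi1 y - 1))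
      by (rewrite Hsc; ring).
    ring. }
  assert (Hprod : forall u v B C, Rabs u <= B -> Rabs v <= C ->
                    - (B * C) <= u * v <= B * C).
  { intros u v B C Hu Hv; apply Rabs_le_between; rewrite Rabs_mult.
    apply Rmult_le_compat; auto using Rabs_pos. }
  pose proof (Hprod _ _ 1 b (proj2 (Rabs_le_between _ _) (COS_bound y)) H2) as Hc2.
  pose proof (Hprod _ _ 1 c (proj2 (Rabs_le_between _ _) (SIN_bound y)) H3) as Hs3.
  pose proof (Hprod _ _ M a (HM y) H1) as HM1.
  pose proof (Rle_trans _ _ _ (Rabs_pos _) H1) as Ha.
  pose proof (Rle_trans _ _ _ (Rabs_pos _) H2) as Hb.
  pose proof (Rle_trans _ _ _ (Rabs_pos _) H3) as Hc.
  pose proof (Rle_trans _ _ _ (Rabs_pos _) (HM y)) as HM0.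
  apply Rabs_le_between in H1.
  assert (Hhb : G h y <= eps + eps * a + K * (a + b + c)).
  { rewrite Hhy; apply Rplus_le_compat.
    - apply Rplus_le_compat_l, Rmult_le_compat_l; lra.
    - apply Rmult_le_compat_l; lra. }
  (* These terms raise the coefficient [K] of [b] and [c] to the common [eps + K + M]. *)
  assert (0 <= eps * (b + c)) by (apply Rmult_le_pos; lra).
  assert (0 <= M * (b + c)) by (apply Rmult_le_pos; lra).
  apply Rabs_le; lra.
Qed.

End PositiveOperator.

Theorem corollary2
  (s : nat -> R) (Hs : power_series_method s) (Hreg : regular s)
  (G : nat -> C2pi -> Bounded)
  (Hlin : forall j : nat, linear_operator (G j))
  (Hpos : forall j : nat, positive_operator (G j)) :
  (forall psi : C2pi,
     st_lim s (fun j => sup_norm (fun y => G j psi y - psi y)) 0)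
  <->
  (st_lim s (fun j => sup_norm (fun y => G j psi1 y - psi1 y)) 0 /\
   st_lim s (fun j => sup_norm (fun y => G j psi2 y - psi2 y)) 0 /\
   st_lim s (fun j => sup_norm (fun y => G j psi3 y - psi3 y)) 0).
Proof.
  split; [intros H; repeat split; apply H |].
  intros (H1 & H2 & H3) psi eps Heps.
  assert (Heps2 : 0 < eps / 2) by lra.
  destruct (C2pi_bounded psi) as [M [HM HMb]].
  destruct (C2pi_modulus psi (eps / 2) Heps2) as [K [HK Hmod]].
  set (C := eps / 2 + K + M).
  assert (HC : 0 < C) by (unfold C; lra).
  (* Chosen so that [C * (3 * e) = eps / 2]: three test norms below [e] force the norm for [psi]
     below [eps]. *)
  set (e := eps / (6 * C)).
  assert (He : 0 < e) by (unfold e; apply Rdiv_lt_0_compat; lra).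
  (* The union of three sets is treated as one set together with a union of two. *)
  apply (density_zero_subset_union s _ _
           (fun j => Rabs (sup_norm (fun y => G j psi2 y - psi2 y) - 0) >= e \/
                     Rabs (sup_norm (fun y => G j psi3 y - psi3 y) - 0) >= e)
           Hs) with (2 := H1 e He);
    [| exact (density_zero_subset_union s _ _ _ Hs (fun j H => H)
                (H2 e He) (H3 e He))].
  intros j Hj; simpl in Hj |- *.
  set (a := sup_norm (fun y => G j psi1 y - 1)) in *.
  assert (Hnn : forall f, 0 <= sup_norm (fun y => G j f y - f y)).
  { intros f; eapply Rle_trans; [apply Rabs_pos |].
    exact (Rabs_le_operator_sup_norm (G j) f 0). }
  pose proof (positive_operator_estimate (G j) (Hlin j) (Hpos j) psi
                (eps / 2) K M (Rlt_le _ _ Heps2) HK HMb Hmod) as Hest.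
  pose proof (Hnn psi1) as Ha; pose proof (Hnn psi2) as Hb;
    pose proof (Hnn psi3) as Hc; pose proof (Hnn psi) as Hp.
  simpl in Hest, Ha, Hb, Hc; fold a in Hest, Ha; fold C in Hest.
  set (b := sup_norm (fun y => G j psi2 y - cos y)) in *.
  set (c := sup_norm (fun y => G j psi3 y - sin y)) in *.
  rewrite Rminus_0_r, Rabs_pos_eq in Hj by exact Hp.
  rewrite !Rminus_0_r, !Rabs_pos_eq by assumption.
  destruct (Rlt_le_dec a e); [right | left; lra].
  destruct (Rlt_le_dec b e); [right | left; lra].
  destruct (Rlt_le_dec c e); [exfalso | lra].
  assert (C * (a + b + c) < C * (3 * e)) by (apply Rmult_lt_compat_l; lra).
  assert (C * (3 * e) = eps / 2) by (unfold e; field; lra).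
  lra.
Qed.
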